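(* There exists a constant $C>0$ such that for every $\alpha\in(0,1)$, $T>0$, $\delta\in(0,T)$, every integer $K\ge 0$ and every integer $J\ge 1$, the exponential sum $S=S_{\alpha,\delta,T,K,J}$ defined in the context satisfies, for each $t\in[0,T-\delta]$, $$\left|w(t+\delta)-S(t)\right|\le C_{KJ}\left(\alpha,\delta T^{-1}\right) w(t+\delta),$$ where $w(t)=t^{-1+\alpha}/\Gamma(\alpha)$ and $$C_{KJ}(\alpha,\eta)=C A_J+B_K(\alpha,\eta),\qquad A_J=J\left(3+\sqrt{8}\right)^{-2J},\qquad B_K(\alpha,\eta)=\frac{\Gamma\left(1-\alpha,\eta 2^K\right)}{\Gamma(1-\alpha)}.$$
   Context: $\Gamma(\cdot)$ is the gamma function and $\Gamma(a,x)=\int_x^\infty s^{a-1}\mathrm{e}^{-s}\,\mathrm{d}s$ is the upper incomplete gamma function. For $a,b>-1$, let $\xi^{(a,b)}_1,\ldots,\xi^{(a,b)}_J$ and $\omega^{(a,b)}_1,\ldots,\omega^{(a,b)}_J$ be the nodes and weights of the $J$-point Gauss-Jacobi (Gaussian) quadrature rule on $(-1,1)$ associated with the weight $w^{(a,b)}(x)=(1-x)^a(1+x)^b$, i.e. $\int_{-1}^1 f(x)w^{(a,b)}(x)\,\mathrm{d}x\approx\sum_{j=1}^J\omega^{(a,b)}_j f(\xi^{(a,b)}_j)$, exact for polynomials of degree at most $2J-1$. Definition of $S$: given $\alpha\in(0,1)$, $0<\delta<T$, integers $K\ge0$, $J\ge1$, set $$C(\alpha)=\frac{1}{\Gamma(\alpha)\Gamma(1-\alpha)}=\frac{\sin(\pi\alpha)}{\pi},\qquad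 r_0=c_0=\frac{1}{2T},\qquad r_k=\frac{1}{2T}2^{k-1},\quad c_k=3r_k\quad(k=1,\ldots,K),$$ $$a_{0j}=r_0\xi^{(0,-\alpha)}_j+c_0,\qquad b_{0j}=C(\alpha)\,\mathrm{e}^{-\delta a_{0j}}\,r_0^{1-\alpha}\,\omega^{(0,-\alpha)}_j\qquad(j=1,\ldots,J),$$ and for $k=1,\ldots,K$, $$a_{kj}=r_k\xi^{(0,0)}_j+c_k,\qquad b_{kj}=C(\alpha)\,\mathrm{e}^{-\delta a_{kj}}\,a_{kj}^{-\alpha}\,r_k\,\omega^{(0,0)}_j\qquad(j=1,\ldots,J).$$ Then $$S(t)=\sum_{k=0}^K\sum_{j=1}^J b_{kj}\,\mathrm{e}^{-a_{kj}t}.$$ *)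

(* Defs.v *)
From HB Require Import structures.
From mathcomp Require Import all_boot all_order all_algebra.
From mathcomp Require Import all_classical all_reals all_analysis.

Set Implicit Arguments.
Unset Strict Implicit.
Unset Printing Implicit Defensive.

Import Order.TTheory GRing.Theory Num.Theory.
Import numFieldNormedType.Exports.

Local Open Scope classical_set_scope.
Local Open Scope ring_scope.

Section defs.
Context {R : realType}.
Implicit Types (a b x t alpha T delta eta C : R) (J K k : nat).

(* Used only where the integral converges (a > 0). *)
Definition Gamma a : R :=
  \int[lebesgue_measure]_(s in `]0, +oo[) (s `^ (a - 1) * expR (- s)).

Definition upper_Gamma a x : R :=
  \int[lebesgue_measure]_(s in `]x, +oo[) (s `^ (a - 1) * expR (- s)).

Definition jacobi_weight a b x : R := (1 - x) `^ a * (1 + x) `^ b.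

(* [size p] is the degree plus one, so [size p <= 2 * J] means that
   the degree of p is at most 2J - 1. For a, b > -1 these conditions determine
   the rule up to a renumbering of the nodes. *)
Definition gauss_jacobi a b J (xi omega : 'I_J -> R) : Prop :=
  [/\ forall j, -1 < xi j < 1,
      injective xi &
      forall p : {poly R}, (size p <= 2 * J)%N ->
        \int[lebesgue_measure]_(x in `]-1, 1[) (p.[x] * jacobi_weight a b x) =
        \sum_(j < J) omega j * p.[xi j]].

Definition wker alpha t : R := t `^ (-1 + alpha) / Gamma alpha.

Definition Calpha alpha : R := (Gamma alpha * Gamma (1 - alpha))^-1.

Definition radius T k : R :=
  if k is k'.+1 then (2 * T)^-1 * 2 ^+ k' else (2 * T)^-1.

Definition centre T k : R := if k is _.+1 then 3 * radius T k else radius T 0.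

(* In [expS], (xi0, om0) is the rule for the exponents (0, -alpha), which serves
   the interval k = 0, and (xi, om) is the Gauss-Legendre rule, with exponents
   (0, 0), which serves the intervals k >= 1. *)
Definition acoef T J (xi0 xi : 'I_J -> R) k (j : 'I_J) : R :=
  if k is _.+1 then radius T k * xi j + centre T k
  else radius T 0 * xi0 j + centre T 0.

Definition bcoef alpha delta T J (xi0 om0 xi om : 'I_J -> R) k (j : 'I_J) : R :=
  let akj := acoef T xi0 xi k j in
  if k is _.+1 then
    Calpha alpha * expR (- (delta * akj)) * akj `^ (- alpha) * radius T k * om j
  else
    Calpha alpha * expR (- (delta * akj)) * radius T 0 `^ (1 - alpha) * om0 j.

Definition expS alpha delta T K J (xi0 om0 xi om : 'I_J -> R) t : R :=
  \sum_(k < K.+1) \sum_(j < J)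
    bcoef alpha delta T xi0 om0 xi om k j * expR (- (acoef T xi0 xi k j * t)).

Definition AJ J : R := J%:R * (3 + Num.sqrt 8) ^- (2 * J).

Definition BK K alpha eta : R :=
  upper_Gamma (1 - alpha) (eta * 2 ^+ K) / Gamma (1 - alpha).

Definition CKJ C K J alpha eta : R := C * AJ J + BK K alpha eta.

End defs.

(* Main.v *)
Require Import Defs.
From HB Require Import structures.
From mathcomp Require Import all_boot all_order all_algebra.
From mathcomp Require Import all_classical all_reals all_analysis.
From mathcomp Require Import measurable_realfun ring lra zify.

(* Writing [tau = t + delta], the substitution [s = p * tau] in the Laplace
   integral of [p^(-alpha)] reduces the claim to [Gamma (1 - alpha)], the
   integral of [s^(-alpha) e^(-s)] over [(0, +oo)], cut at the points
   [2^k tau / T] for [0 <= k <= K]. The part beyond the last point is at most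
   [upper_Gamma (1 - alpha) (2^K delta / T)], which is the term [BK].

   On each remaining piece the quadrature error is at most twice the mass of
   the weight times the distance of the integrand [f] to the polynomials of
   degree less than [2J]. Since [x^k] is a nonnegative combination of Chebyshev
   polynomials, whenever [f (- x)] is a limit of polynomials with nonnegative
   coefficients this distance is at most [2 r^(-2J) f (- h)] with
   [h = (r + 1/r) / 2]; no complex analysis is needed. For
   [f x = (x + 3)^(-alpha) e^(- lam (x + 3))] one can take [h] up to
   [3 - 1 / (2J)], and then [r^(-2J)] is comparable to [(3 + sqrt 8)^(-2J)].

   With [m = lam / (2J)] the error of the piece of parameter [lam] becomes
   [O(J (3 + sqrt 8)^(-2J) m^(1 - alpha) e^(- m))]. As [m] runs through a
   dyadic sequence, the sum of [m^(1 - alpha) e^(- m)] is at most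
   [2 Gamma (1 - alpha)], by comparison with the integral of
   [s^(-alpha) e^(-s)], so the bound is uniform in [K] and [alpha]. *)

Import Order.TTheory GRing.Theory Num.Theory.
Import numFieldNormedType.Exports.

Local Open Scope ring_scope.

Set Implicit Arguments.
Unset Strict Implicit.

(** * Chebyshev expansion of polynomials with nonnegative coefficients *)

Section chebyshev.
Context {R : realType}.
Implicit Types (r x y h c : R) (m n k : nat).

(** Carrying two consecutive Chebyshev polynomials of the first kind makes the three-term recurrence
    structural. *)
Fixpoint cheb2 n : {poly R} * {poly R} :=
  if n is n'.+1 then let: (p, q) := cheb2 n' in (q, 2 *: ('X * q) - p)
  else (1, 'X).

Definition cheb n := (cheb2 n).1.

Lemma cheb0 : cheb 0 = 1. Proof. by []. Qed.

Lemma cheb1 : cheb 1 = 'X. Proof. by []. Qed.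

Lemma chebSS n : cheb n.+2 = 2 *: ('X * cheb n.+1) - cheb n.
Proof. by rewrite /cheb /=; case: (cheb2 n). Qed.

Lemma cheb_ind (P : nat -> Prop) :
  P 0 -> P 1 -> (forall n, P n -> P n.+1 -> P n.+2) -> forall n, P n.
Proof.
by move=> P0 P1 PSS n; suff [] : P n /\ P n.+1 by []; elim: n => [|n [? ?]];
  split=> //; exact: PSS.
Qed.

Lemma size_cheb n : (size (cheb n) <= n.+1)%N.
Proof.
elim/cheb_ind: n => [||n IH0 IH1]; first by rewrite cheb0 size_poly1.
  by rewrite cheb1 size_polyX.
rewrite chebSS (leq_trans (size_polyD _ _))// geq_max size_polyN.
rewrite (leq_trans IH0) ?andbT; last by rewrite ltnW.
rewrite (leq_trans (size_scale_leq _ _))// (leq_trans (size_polyMleq _ _))//.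
by rewrite size_polyX.
Qed.

Lemma horner_chebSS n x :
  (cheb n.+2).[x] = 2 * x * (cheb n.+1).[x] - (cheb n).[x].
Proof. by rewrite chebSS hornerD hornerN hornerZ hornerM hornerX mulrA. Qed.

Lemma horner_cheb0 x : (cheb 0).[x] = 1.
Proof. by rewrite cheb0 hornerE. Qed.

Lemma horner_cheb1 x : (cheb 1).[x] = x.
Proof. by rewrite cheb1 hornerX. Qed.

Lemma cheb_cos n x : (cheb n).[cos x] = cos (n%:R * x).
Proof.
elim/cheb_ind: n => [||n IH0 IH1].
- by rewrite cheb0 mul0r cos0 hornerE.
- by rewrite cheb1 mul1r hornerE.
rewrite horner_chebSS IH0 IH1.
have -> : n.+2%:R * x = n.+1%:R * x + x by rewrite -addn1 natrD; ring.
have -> : n%:R * x = n.+1%:R * x - x by rewrite -[n.+1]addn1 natrD; ring.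
by rewrite cosB cosD; ring.
Qed.

Lemma cheb_norm_le1 n x : -1 <= x <= 1 -> `|(cheb n).[x]| <= 1.
Proof.
move=> x1; rewrite -(acosK (x := x)) ?in_itv//= cheb_cos.
by rewrite ler_norml cos_geN1 cos_le1.
Qed.

(** For [1 <= r], the right vertex of the Bernstein ellipse of parameter [r]. *)
Definition joukowski r := (r + r^-1) / 2.

Lemma cheb_joukowski n r : r != 0 ->
  (cheb n).[joukowski r] = (r ^+ n + r ^- n) / 2.
Proof.
move=> r0; elim/cheb_ind: n => [||n IH0 IH1].
- by rewrite cheb0 hornerE expr0 invr1; lra.
- by rewrite cheb1 hornerE expr1.
have rn0 : r ^+ n != 0 by rewrite expf_neq0.
rewrite horner_chebSS IH0 IH1 /joukowski !exprS.
by field; rewrite rn0 r0.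
Qed.

Lemma cheb_joukowski_ge n r : 0 < r -> r ^+ n / 2 <= (cheb n).[joukowski r].
Proof.
move=> r0; rewrite cheb_joukowski ?gt_eqF// ler_pM2r// lerDl invr_ge0.
by rewrite exprn_ge0// ltW.
Qed.

(** The factor [cheb m] makes an induction on [k] possible: [x T_(m+1)] is the mean of [T_m] and
    [T_(m+2)], and the right-hand side obeys the same recurrence at [joukowski r]. *)
Lemma XnM_cheb_approx n r k m : 1 <= r -> exists2 p : {poly R},
  (size p <= n)%N &
  forall x, -1 <= x <= 1 ->
    `|x ^+ k * (cheb m).[x] - p.[x]| <=
    2 * r ^- n * (joukowski r ^+ k * (cheb m).[joukowski r]).
Proof.
move=> r1; have r0 : 0 < r by rewrite (lt_le_trans _ r1).
elim: k m => [m|k IH [|m]].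
(* [T_m] is kept when its degree is below [n] and replaced by 0 otherwise, at a cost of at most
   [1 <= 2 r^(-n) (r^m / 2)]. *)
- have [mn|nm] := ltnP m n.
    exists (cheb m) => [|x x1]; first exact: leq_trans (size_cheb m) mn.
    rewrite !expr0 !mul1r subrr normr0 mulr_ge0// ?mulr_ge0 ?invr_ge0//.
      by rewrite exprn_ge0// ltW.
    by rewrite (le_trans _ (cheb_joukowski_ge _ _))// divr_ge0// exprn_ge0// ltW.
  exists 0 => [|x x1]; first by rewrite size_poly0.
  rewrite horner0 subr0 !expr0 !mul1r (le_trans (cheb_norm_le1 _ x1))//.
  rewrite [leLHS](_ : 1 = 2 * r ^- n * (r ^+ n / 2)); last first.
    by field; rewrite expf_neq0 ?gt_eqF.
  rewrite ler_pM2l ?mulr_gt0 ?invr_gt0 ?exprn_gt0//.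
  rewrite (le_trans _ (cheb_joukowski_ge _ _))// ler_pM2r ?invr_gt0//.
  by rewrite ler_weXn2l.
(* Here [m = 0], and [x T_0 = T_1]. *)
- have [p sp pP] := IH 1; exists p => // x /pP.
  by rewrite !horner_cheb0 !horner_cheb1 !mulr1 !exprSr.
- have [p sp pP] := IH m; have [q sq qP] := IH m.+2.
  exists (2^-1 *: (p + q)) => [|x x1].
    rewrite (leq_trans (size_scale_leq _ _))// (leq_trans (size_polyD _ _))//.
    by rewrite geq_max sp.
  have := lerD (pP _ x1) (qP _ x1).
  move=> /(le_trans (ler_normD _ _)).
  rewrite !horner_chebSS hornerZ hornerD !exprSr.
  set u := _ + _; set v := _ + _ => uv.
  rewrite [X in `|X|](_ : _ = u / 2); last by rewrite /u; lra.
  rewrite normrM [`|2^-1|]ger0_norm// ler_pdivrMr//.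
  by rewrite (le_trans uv)// le_eqVlt; apply/orP; left; apply/eqP; rewrite /v; ring.
Qed.

(* [x^k] is a nonnegative combination of Chebyshev polynomials [T_m]; dropping
   those with [m >= n] costs at most the sum of their coefficients, which is
   controlled by the value [h ^+ k] of the combination at [h = joukowski r],
   as [T_m h >= r ^+ m / 2]. *)
Lemma Xn_approx n r k : 1 <= r -> exists2 p : {poly R},
  (size p <= n)%N &
  forall x, -1 <= x <= 1 ->
    `|x ^+ k - p.[x]| <= 2 * r ^- n * joukowski r ^+ k.
Proof.
move=> r1; have [p sp pP] := @XnM_cheb_approx n r k 0 r1.
by exists p => // x /pP; rewrite !horner_cheb0 !mulr1.
Qed.

Definition nnpoly (q : {poly R}) := forall i, 0 <= q`_i.

Lemma nnpolyC c : 0 <= c -> nnpoly c%:P.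
Proof. by move=> c0 i; rewrite coefC; case: ifP. Qed.

Lemma nnpolyD (p q : {poly R}) : nnpoly p -> nnpoly q -> nnpoly (p + q).
Proof. by move=> p0 q0 i; rewrite coefD addr_ge0. Qed.

Lemma nnpolyZ c (q : {poly R}) : 0 <= c -> nnpoly q -> nnpoly (c *: q).
Proof. by move=> c0 q0 i; rewrite coefZ mulr_ge0. Qed.

Lemma nnpolyM (p q : {poly R}) : nnpoly p -> nnpoly q -> nnpoly (p * q).
Proof. by move=> p0 q0 i; rewrite coefM sumr_ge0// => j _; rewrite mulr_ge0. Qed.

Lemma nnpolyX (q : {poly R}) n : nnpoly q -> nnpoly (q ^+ n).
Proof.
move=> q0; elim: n => [|n IH]; first by rewrite expr0; exact: nnpolyC.
by rewrite exprS; exact: nnpolyM.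
Qed.

Lemma nnpoly_sum (I : Type) (s : seq I) (P : pred I) (F : I -> {poly R}) :
  (forall i, P i -> nnpoly (F i)) -> nnpoly (\sum_(i <- s | P i) F i).
Proof.
by move=> F0; elim/big_ind: _ => //; [exact: nnpolyC|exact: nnpolyD].
Qed.

(** The approximants of the monomials are combined with the coefficients of [q]. The signs coming
    from [- x] disappear in absolute value, and the bounds add up to the value of [q] at one point
    because its coefficients are nonnegative. *)
Lemma nnpoly_approx n r (q : {poly R}) : 1 <= r -> nnpoly q ->
  exists2 p : {poly R}, (size p <= n)%N &
  forall x, -1 <= x <= 1 ->
    `|q.[- x] - p.[x]| <= 2 * r ^- n * q.[joukowski r].
Proof.
move=> r1 q0.
pose P k (p : {poly R}) := (size p <= n)%N /\ forall x, -1 <= x <= 1 ->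
    `|x ^+ k - p.[x]| <= 2 * r ^- n * joukowski r ^+ k.
have [p pP] : {p & forall k, P k (p k)}.
  apply: (@choice _ _ P) => k.
  by have [p sp pP] := @Xn_approx n r k r1; exists p.
exists (\sum_(i < size q) (q`_i * (-1) ^+ i) *: p i) => [|x x1].
  apply: (leq_trans (size_sum _ _ _)); apply/bigmax_leqP => i _.
  by rewrite (leq_trans (size_scale_leq _ _))//; case: (pP i).
rewrite !(horner_coef q) horner_sum -sumrB mulr_sumr.
rewrite (le_trans (ler_norm_sum _ _ _))// ler_sum// => i _.
rewrite hornerZ (exprNn x).
rewrite [X in `|X|](_ : _ = q`_i * ((-1) ^+ i * (x ^+ i - (p i).[x]))); last by ring.
rewrite [leRHS](_ : _ = q`_i * (2 * r ^- n * joukowski r ^+ i)); last by ring.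
rewrite !normrM normrX normrN1 expr1n mul1r ger0_norm// ler_wpM2l//.
by case: (pP i) => _ /(_ _ x1).
Qed.

End chebyshev.

Section nnlim.
Local Open Scope classical_set_scope.
Context {R : realType}.
Implicit Types (x y h c : R) (n : nat) (p q : {poly R}) (f g : R -> R).

(** A uniform closure on [[-h, h]] stands in for power series with nonnegative coefficients:
    stability under sums and exponentials is then proved without handling infinite coefficient
    sequences. *)
Definition nnlim h f := forall e, 0 < e -> exists2 q : {poly R},
  nnpoly q & forall y, `|y| <= h -> `|f y - q.[y]| <= e.

Lemma nnpoly_horner_le q h y : nnpoly q -> `|y| <= h ->
  `|q.[y]| <= q.[h].
Proof.
move=> q0 yh; rewrite !horner_coef (le_trans (ler_norm_sum _ _ _))//.
apply: ler_sum => i _; have qi0 := q0 i.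
rewrite normrM (ger0_norm qi0) ler_wpM2l// normrX.
by apply: lerXn2r => //; rewrite nnegrE (le_trans _ yh).
Qed.

Lemma nnlim_poly h q : nnpoly q -> nnlim h (horner q).
Proof. by move=> q0 e e0; exists q => // y _; rewrite subrr normr0 ltW. Qed.

Lemma eq_nnlim h f g : (forall y, `|y| <= h -> f y = g y) ->
  nnlim h f -> nnlim h g.
Proof.
by move=> fg + e e0 => /(_ e e0)[q q0 qP]; exists q => // y yh; rewrite -fg ?qP.
Qed.

Lemma nnlimD h f g : nnlim h f -> nnlim h g -> nnlim h (fun y => f y + g y).
Proof.
move=> fh gh e e0.
have [|p p0 pP] := fh (e / 2); first by rewrite divr_gt0.
have [|q q0 qP] := gh (e / 2); first by rewrite divr_gt0.
exists (p + q) => [|y yh]; first exact: nnpolyD.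
rewrite hornerD opprD addrACA (le_trans (ler_normD _ _))// (splitr e).
by rewrite lerD ?pP ?qP.
Qed.

Lemma nnlimZ h f c : 0 <= c -> nnlim h f -> nnlim h (fun y => c * f y).
Proof.
move=> c0 fh e e0; have c1 : 0 < c + 1 by lra.
have [|p p0 pP] := fh (e / (c + 1)); first by rewrite divr_gt0.
exists (c *: p) => [|y yh].
  exact: nnpolyZ.
rewrite hornerZ -mulrBr normrM (ger0_norm c0).
rewrite (le_trans (ler_wpM2l c0 (pP _ yh)))// mulrCA ler_piMr ?(ltW e0)//.
by rewrite ler_pdivrMr// mul1r; lra.
Qed.

(** The tail at [x] is dominated term by term by the tail at [y]. This reduces uniform convergence
    on an interval to convergence at its right endpoint. *)
Lemma exp_partial_sum_le x y n : `|x| <= y ->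
  `|expR x - series (exp_coeff x) n| <= expR y - series (exp_coeff y) n.
Proof.
move=> xy; have cv z : series (exp_coeff z) m @[m --> \oo] --> expR z.
  exact: is_cvg_series_exp_coeff.
have cx : `|series (exp_coeff x) m - series (exp_coeff x) n| @[m --> \oo] -->
    `|expR x - series (exp_coeff x) n|.
  by apply: cvg_norm; apply: cvgB; [exact: cv|exact: cvg_cst].
have cy : (series (exp_coeff y) m - series (exp_coeff y) n) @[m --> \oo] -->
    expR y - series (exp_coeff y) n.
  by apply: cvgB; [exact: cv|exact: cvg_cst].
apply: (ler_cvg_to cx cy); near=> m.
have nm : (n <= m)%N by near: m; exact: nbhs_infty_ge.
rewrite !sub_series_geq// (le_trans (ler_norm_sum _ _ _))// ler_sum// => i _.
rewrite /exp_coeff/= normrM normrX [`|_^-1|]ger0_norm ?invr_ge0// ler_wpM2r ?invr_ge0//.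
by apply: lerXn2r => //; rewrite nnegrE (le_trans _ xy).
Unshelve. all: by end_near. Qed.

(** The truncated exponential series in [q] has nonnegative coefficients, and its error is largest
    at [h], so one truncation index serves every [y]. *)
Lemma nnlim_exp_poly h q : 0 <= h -> nnpoly q ->
  nnlim h (fun y => expR q.[y]).
Proof.
move=> h0 q0 e e0.
have : \forall n \near \oo, `|expR q.[h] - series (exp_coeff q.[h]) n| <= e.
  apply: cvgr_dist_le => //; exact: is_cvg_series_exp_coeff.
move=> [n _ /(_ n (leqnn n))] /= ne.
exists (\sum_(0 <= i < n) (i`!%:R^-1 *: q ^+ i)) => [|y yh].
  by apply: nnpoly_sum => i _; apply: nnpolyZ; rewrite ?invr_ge0//; exact: nnpolyX.
have -> : (\sum_(0 <= i < n) (i`!%:R^-1 *: q ^+ i)).[y] =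
    series (exp_coeff q.[y]) n.
  rewrite horner_sum; apply: eq_bigr => i _.
  by rewrite hornerZ horner_exp mulrC.
rewrite (le_trans (exp_partial_sum_le _ (nnpoly_horner_le q0 yh)))//.
by rewrite (le_trans _ ne)// ler_norm.
Qed.

Lemma expRB1_norm_le x : `|x| <= 2^-1 -> `|1 - expR x| <= 2 * `|x|.
Proof.
rewrite ler_norml => /andP[xl xr]; have := expR_ge1Dx x.
have := expR_ge1Dx (- x); rewrite expRN.
have := expR_gt0 x; set E := expR x => E0.
rewrite -(ler_pM2r E0) mulVf ?gt_eqF// => E1 E2.
have [x0|x0] := lerP 0 x; rewrite ?(ger0_norm x0) ?(ltr0_norm x0) ler_norml.
  by apply/andP; split; nra.
by apply/andP; split; nra.
Qed.

Lemma nnlim_exp h f : 0 <= h -> nnlim h f -> nnlim h (fun y => expR (f y)).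
Proof.
(* The crude approximant [q1] only provides an upper bound [B] for [expR (f y)]. *)
move=> h0 fh e e0; have [//|q1 q10 q1P] := fh 1.
pose B := expR (1 + q1.[h]); have B0 : 0 < B by exact: expR_gt0.
have fB y : `|y| <= h -> expR (f y) <= B.
  move=> yh; rewrite ler_expR; have := q1P _ yh; rewrite ler_norml => /andP[_].
  have := le_trans (ler_norm _) (nnpoly_horner_le q10 yh); lra.
(* The bound [2^-1] is what [expRB1_norm_le] asks for; [e / (4 * B)] makes the resulting error
   [B * (2 * (e / (4 * B)))] equal to [e / 2]. *)
have d0 : 0 < Num.min 2^-1 (e / (4 * B)).
  by rewrite lt_min invr_gt0 ltr0n/= divr_gt0// mulr_gt0.
have [q q0 qP] := fh _ d0.
have [|p p0 pP] := nnlim_exp_poly h0 q0 (e := e / 2); first by rewrite divr_gt0.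
exists p => // y yh; have := qP _ yh; rewrite le_min => /andP[fq fqe].
rewrite (le_trans (ler_distD (expR q.[y]) _ _))//.
rewrite (splitr e) lerD ?pP//.
have -> : expR (f y) - expR q.[y] = expR (f y) * (1 - expR (q.[y] - f y)).
  by rewrite mulrBr mulr1 -expRD addrCA subrr addr0.
rewrite normrM (ger0_norm (expR_ge0 _)).
rewrite distrC in fq fqe.
rewrite (le_trans (ler_wpM2l (expR_ge0 _) (expRB1_norm_le fq)))//.
rewrite (le_trans (ler_wpM2r _ (fB _ yh))) ?mulr_ge0//.
rewrite (le_trans (ler_wpM2l (ltW B0) (ler_wpM2l _ fqe)))//.
by rewrite le_eqVlt; apply/orP; left; apply/eqP; field; rewrite gt_eqF.
Qed.

(** The Taylor polynomial of degree [n] of [- ln (1 - y)] at 0. *)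
Definition lnB_poly n : {poly R} := \sum_(i < n) (i.+1%:R^-1 *: 'X^(i.+1)).

Lemma horner_deriv_lnB_poly n y : y != 1 ->
  (lnB_poly n)^`().[y] = (1 - y ^+ n) / (1 - y).
Proof.
move=> y1; have y10 : 1 - y != 0 by rewrite subr_eq0 eq_sym.
rewrite /lnB_poly raddf_sum/= horner_sum.
transitivity (\sum_(i < n) y ^+ i).
  apply: eq_bigr => i _; rewrite derivZ derivXn hornerZ/= hornerMn hornerXn.
  by rewrite -(mulr_natl (y ^+ i)) mulKf// pnatr_eq0.
by rewrite -[1 - y ^+ n]opprB subrX1 -mulNr opprB mulrAC divff// mul1r.
Qed.

(** The difference vanishes at 0 and has derivative [y^n / (1 - y)], so the mean value theorem
    applies; the extra factor [|y| < 1] is dropped. *)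
Lemma lnB_poly_le n h y : h < 1 -> `|y| <= h ->
  `|- ln (1 - y) - (lnB_poly n).[y]| <= h ^+ n / (1 - h).
Proof.
move=> h1 yh; have h0 : 0 <= h by rewrite (le_trans _ yh).
have h10 : 0 < 1 - h by lra.
pose D := fun y : R => - ln (1 - y) - (lnB_poly n).[y].
pose dD := fun y : R => y ^+ n / (1 - y).
have dDP (z : R) : `|z| <= h -> is_derive z 1 D (dD z).
  move=> zh; have z1 : 0 < 1 - z by move: zh; rewrite ler_norml; lra.
  have dl : is_derive (1 - z) 1 (@ln R) (1 - z)^-1 by exact: is_derive1_ln.
  have db : is_derive z (1 : R) (cst 1 - id) (0 - 1) by exact: is_deriveB.
  have dc : is_derive z (1 : R) (@ln R \o (cst 1 - id)) ((1 - z)^-1 * (0 - 1)).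
    exact: is_derive1_comp.
  have dp := is_derive_poly (lnB_poly n) z.
  have := is_deriveB (is_deriveN dc) dp.
  rewrite horner_deriv_lnB_poly; last by lra.
  rewrite [X in is_derive _ _ _ X -> _](_ : _ = dD z)//.
  by rewrite /dD; field; lra.
have D0 : D 0 = 0.
  rewrite /D subr0 ln1 oppr0 sub0r /lnB_poly horner_sum big1 ?oppr0// => i _.
  by rewrite hornerZ hornerXn expr0n mulr0.
have dDle z : `|z| <= h -> `|dD z| <= h ^+ n / (1 - h).
  move=> zh; have := zh; rewrite ler_norml => /andP[zl zr].
  rewrite /dD normrM normrX ler_pM ?exprn_ge0//.
    by apply: lerXn2r; rewrite // nnegrE.
  by rewrite normfV ger0_norm ?lef_pV2 ?posrE; lra.
suff : exists2 c, `|c| <= h & D y = dD c * y.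
  move=> [c ch]; rewrite -/(D y) => ->; rewrite normrM.
  by rewrite -[leRHS]mulr1 ler_pM ?dDle// (le_trans yh) ?ltW.
have Dc z : `|z| <= h -> {for z, continuous D}.
  move=> zh; apply/differentiable_continuous/derivable1_diffP.
  by have [] := dDP _ zh.
have := yh; rewrite ler_norml => /andP[yl yr].
have [y0|/ltW y0] := lerP 0 y.
  have [||c] := @MVT_segment _ D dD 0 y y0.
  - by move=> z; rewrite in_itv/= => zy; apply: dDP; rewrite ler_norml; lra.
  - apply: derivable_within_continuous => z; rewrite in_itv/= => zy.
    by have [] : is_derive z 1 D (dD z) by apply: dDP; rewrite ler_norml; lra.
  rewrite in_itv/= D0 !subr0 => cy ->; exists c => //.
  by rewrite ler_norml; lra.
have [||c] := @MVT_segment _ D dD y 0 y0.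
- by move=> z; rewrite in_itv/= => zy; apply: dDP; rewrite ler_norml; lra.
- apply: derivable_within_continuous => z; rewrite in_itv/= => zy.
  by have [] : is_derive z 1 D (dD z) by apply: dDP; rewrite ler_norml; lra.
rewrite in_itv/= D0 !sub0r mulrN => cy /oppr_inj ->; exists c => //.
by rewrite ler_norml; lra.
Qed.

Lemma nnlim_lnB h : 0 <= h < 1 -> nnlim h (fun y => - ln (1 - y)).
Proof.
move=> /andP[h0 h1] e e0; have h10 : 0 < 1 - h by lra.
have : \forall n \near \oo, `|0 - h ^+ n| <= e * (1 - h).
  apply: cvgr_dist_le; last by rewrite mulr_gt0.
  by apply: cvg_expr; rewrite ger0_norm.
move=> [n _ /(_ n (leqnn n))] /=; rewrite sub0r normrN => ne.
exists (lnB_poly n) => [|y yh].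
  apply: nnpoly_sum => i _; apply: nnpolyZ; rewrite ?invr_ge0//.
  by move=> j; rewrite coefXn ler0n.
rewrite (le_trans (lnB_poly_le n h1 yh))// ler_pdivrMr//.
by rewrite (le_trans _ ne)// ler_norm.
Qed.

End nnlim.

(** * Polynomial approximation of the kernel *)

Section kernel_approx.
Local Open Scope classical_set_scope.
Context {R : realType}.
Implicit Types (x y h c r e alpha lam : R) (n J : nat) (f : R -> R).

Lemma nnlim_rescale h c f : 0 <= c -> nnlim (c * h) f ->
  nnlim h (fun y => f (c * y)).
Proof.
move=> c0 fh e e0; have [q q0 qP] := fh e e0.
exists (q \Po (c *: 'X)) => [|y yh].
  rewrite comp_polyE; apply: nnpoly_sum => i _; apply: nnpolyZ => //.
  apply: nnpolyX; apply: nnpolyZ => // j.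
  by rewrite coefX; case: eqP.
rewrite horner_comp hornerZ hornerX qP// normrM ger0_norm//.
by rewrite ler_wpM2l.
Qed.

(** The integrand on a piece [k >= 1], carried to [[-1, 1]]; the shift 3 is the ratio of the centre
    to the radius. *)
Definition kern alpha lam x := (x + 3) `^ (- alpha) * expR (- (lam * (x + 3))).

(** Up to the positive constant [3^(-alpha) e^(-3 lam)], the reflected kernel is the exponential of
    [- alpha ln (1 - y / 3) + lam y], to which the closure properties apply. *)
Lemma nnlim_kern h alpha lam : 0 <= h < 3 -> 0 <= alpha -> 0 <= lam ->
  nnlim h (fun y => kern alpha lam (- y)).
Proof.
move=> /andP[h0 h3] a0 l0.
have h31 : 0 <= 3^-1 * h < 1 by apply/andP; split; lra.
have lnh := nnlim_rescale (ltac:(lra) : 0 <= 3^-1 :> R) (nnlim_lnB h31).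
have idh : nnlim h (fun y => y).
  apply: eq_nnlim (nnlim_poly h (q := 'X) _) => [y _|i].
    by rewrite hornerX.
  by rewrite coefX; case: eqP.
have := nnlimZ (expR_ge0 (- (alpha * ln 3) - lam * 3))
  (nnlim_exp h0 (nnlimD (nnlimZ a0 lnh) (nnlimZ l0 idh))).
apply: eq_nnlim => y; rewrite ler_norml => /andP[yl yr].
rewrite /kern /powR gt_eqF; last by lra.
rewrite -!expRD; congr expR.
have -> : - y + 3 = 3 * (1 - 3^-1 * y) by field.
by rewrite lnM ?posrE; [field|lra|lra].
Qed.

Lemma joukowski_ge1 r : 1 <= r -> 1 <= joukowski r.
Proof.
move=> r1; have r0 : 0 < r by lra.
rewrite /joukowski ler_pdivlMr// mul1r -subr_ge0.
rewrite (_ : _ - _ = (r - 1) ^+ 2 / r); last by field; rewrite gt_eqF.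
by rewrite divr_ge0 ?sqr_ge0// ltW.
Qed.

Lemma approx_nnlim n r f e : 1 <= r -> nnlim (joukowski r) f -> 0 < e ->
  exists2 p : {poly R}, (size p <= n)%N &
  forall x, -1 <= x <= 1 ->
    `|f (- x) - p.[x]| <= 2 * r ^- n * f (joukowski r) + e.
Proof.
move=> r1 fh e0; have h1 := joukowski_ge1 r1; have r0 : 0 < r by lra.
(* One third of [e] pays for replacing [f] by [q] at [- x]; the other two pay for the same
   replacement at [joukowski r], which is multiplied by [2 r^(-n) <= 2]. *)
have [|q q0 qP] := fh (e / 3); first by rewrite divr_gt0.
have [p sp pP] := nnpoly_approx n r1 q0; exists p => // x x1.
have rn : r ^- n <= 1 by rewrite invf_le1 ?exprn_gt0// exprn_ege1.
have rn0 : 0 <= r ^- n by rewrite invr_ge0 exprn_ge0// ltW.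
have := qP (joukowski r); rewrite ger0_norm ?lexx; last by lra.
move=> /(_ isT); rewrite ler_norml => /andP[qh _].
have := qP (- x); rewrite normrN => /(_ _)/wrap[|qx].
  by rewrite ler_norml; lra.
rewrite (le_trans (ler_distD q.[- x] _ _))//.
have := lerD qx (pP _ x1); move/le_trans; apply.
have : q.[joukowski r] <= f (joukowski r) + e / 3 by lra.
move=> /(ler_wpM2l rn0) => H.
have := ler_wpM2r (ltac:(lra) : 0 <= e / 3) rn; lra.
Qed.

Definition rho : R := 3 + Num.sqrt 8.

(** This is [joukowski rho = 3] cleared of denominators. *)
Lemma rho_sqr : rho ^+ 2 = 6 * rho - 1.
Proof.
rewrite /rho; have := sqr_sqrtr (ltac:(lra) : 0 <= 8 :> R).
by set s := Num.sqrt 8; rewrite !expr2; nra.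
Qed.

Lemma rho_ge : 5 <= rho.
Proof.
rewrite /rho; suff : 2 <= Num.sqrt 8 :> R by lra.
have : Num.sqrt (2 ^+ 2) <= Num.sqrt 8 :> R by rewrite ler_sqrt; lra.
by rewrite sqrtr_sqr ger0_norm.
Qed.

Lemma kern_approx alpha lam J : (0 < J)%N -> 0 <= alpha -> 0 <= lam ->
  exists2 p : {poly R}, (size p <= 2 * J)%N &
  forall x, -1 <= x <= 1 ->
    `|kern alpha lam x - p.[x]| <=
    5 * rho ^- (2 * J) * ((2 * J%:R) `^ alpha * expR (- (lam / (2 * J%:R)))).
Proof.
move=> J0 a0 l0.
have J1 : 1 <= J%:R :> R by rewrite ler1n.
have rho5 := rho_ge; have rho0 : 0 < rho by lra.
set eps := (2 * J%:R)^-1.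
have eps0 : 0 < eps by rewrite invr_gt0; lra.
have eps1 : eps <= 2^-1 by rewrite lef_pV2 ?posrE; lra.
(* [rho] is the value of [r] with [joukowski r = 3], where [kern _ _ (- h)] is
   singular; shrinking it by the factor [1 - eps / 2] keeps [h] at distance
   [eps] from 3 at the price of a factor 2 only. *)
pose r := rho * (1 - eps / 2).
have r3 : 3 <= r by rewrite /r; nra.
have r0 : 0 < r by lra.
have h3 : joukowski r <= 3 - eps.
  rewrite /joukowski ler_pdivrMr// -(ler_pM2l r0) mulrDr divff ?gt_eqF//.
  have := rho_sqr; rewrite /r expr2 => E.
  have : 3 / 4 <= 1 - eps / 2 < 1 by apply/andP; split; lra.
  set a := 1 - eps / 2 => /andP[a34 a1].
  have -> : eps = 2 - 2 * a by rewrite /a; lra.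
  have -> : rho * a * (rho * a) = (6 * rho - 1) * a * a by rewrite -E; ring.
  (* The goal amounts to [(1 - a) (1 + a) <= (1 - a) (2 rho a)]. *)
  have ra : 1 + a <= 2 * (rho * a) by nra.
  have := ler_wpM2l (ltac:(lra) : 0 <= 1 - a) ra; lra.
have h1 : 1 <= joukowski r by apply: joukowski_ge1; lra.
have rhoJ0 : 0 < rho ^- (2 * J) by rewrite invr_gt0 exprn_gt0.
(* Bernoulli's inequality, with [2 J (eps / 2) = 1 / 2]. *)
have bern : 2^-1 <= (1 - eps / 2) ^+ (2 * J).
  have : forall m, 1 - m%:R * (eps / 2) <= (1 - eps / 2) ^+ m.
    elim=> [|m IH]; first by rewrite mul0r subr0 expr0.
    rewrite exprS -natr1.
    have m0 : 0 <= m%:R :> R by [].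
    have := ler_wpM2l (ltac:(lra) : 0 <= 1 - eps / 2) IH.
    by apply: le_trans; nra.
  move/(_ (2 * J)%N); apply: le_trans.
  rewrite natrM /eps le_eqVlt; apply/orP; left; apply/eqP; field.
  by rewrite gt_eqF//; lra.
have rn : r ^- (2 * J) <= 2 * rho ^- (2 * J).
  rewrite /r exprMn invfM mulrC ler_wpM2r ?(ltW rhoJ0)//.
  by rewrite -[leRHS]invrK lef_pV2 ?posrE ?(lt_le_trans _ bern)// invr_gt0.
pose M := (2 * J%:R) `^ alpha * expR (- (lam / (2 * J%:R))).
have M0 : 0 < M by rewrite mulr_gt0 ?expR_gt0 ?powR_gt0//; lra.
(* This serves as the additive error of [approx_nnlim]; with the factor 2 there and the factor 2
   lost in [rn], the constant is [2 * 2 + 1 = 5]. *)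
have e0 : 0 < rho ^- (2 * J) * M by rewrite mulr_gt0.
have hk : 0 <= joukowski r < 3 by apply/andP; split; lra.
have [|p sp pP] := approx_nnlim (2 * J) _ (nnlim_kern hk a0 l0) e0.
  by lra.
exists p => // x /pP; rewrite opprK => /le_trans; apply.
rewrite -/M; set k := kern _ _ _.
have k0 : 0 <= k by rewrite mulr_ge0 ?powR_ge0 ?expR_ge0.
(* The point [- joukowski r + 3] is at least [eps], and the kernel decreases in it; its value for
   [eps] is [M]. *)
have kM : k <= M.
  rewrite /k /kern /M ler_pM ?powR_ge0 ?expR_ge0//.
    have -> : (2 * J%:R) `^ alpha = eps `^ (- alpha).
      rewrite /eps -powR_inv1; last by lra.
      by rewrite -powRrM mulrN mulN1r opprK.
    rewrite !powRN lef_pV2 ?posrE ?powR_gt0//; last by lra.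
    by apply: ge0_ler_powR; rewrite ?nnegrE; lra.
  rewrite ler_expR lerN2 -/eps ler_wpM2l//; lra.
have := ler_wpM2l (ltW rhoJ0) kM.
have := ler_wpM2r k0 rn.
lra.
Qed.

End kernel_approx.

(** * Error of a Gaussian quadrature rule *)

Section bounded_mul.
Local Open Scope classical_set_scope.
Context d (T : measurableType d) (R : realType) (mu : {measure set T -> \bar R}).
Implicit Types (D : set T) (f w : T -> R) (M : R).

Lemma integrable_bounded_mul D f w M :
  mu.-integrable D (EFin \o w) -> measurable D -> measurable_fun D f ->
  (forall x, D x -> 0 <= w x) -> (forall x, D x -> `|f x| <= M) ->
  mu.-integrable D (EFin \o (fun x => f x * w x)).
Proof.
move=> iw mD mf w0 fM.
apply: (le_integrable mD _ _ (integrableZl mD M iw)) => [|x Dx].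
  apply/measurable_EFinP/measurable_funM => //.
  by apply/measurable_EFinP; exact: measurable_int iw.
rewrite /= lee_fin !normrM ler_wpM2r//.
by rewrite (le_trans (fM _ Dx))// ler_norm.
Qed.

Lemma le_Rintegral_bounded_mul D f w M :
  mu.-integrable D (EFin \o w) -> measurable D -> measurable_fun D f ->
  (forall x, D x -> 0 <= w x) -> (forall x, D x -> `|f x| <= M) ->
  `|\int[mu]_(x in D) (f x * w x)| <= M * \int[mu]_(x in D) w x.
Proof.
move=> iw mD mf w0 fM.
have ifw := integrable_bounded_mul iw mD mf w0 fM.
rewrite (le_trans (le_normr_Rintegral mD ifw))// -RintegralZl//.
apply: le_Rintegral => //.
- exact: integrable_norm.
- exact: (integrableZl mD M iw).
- by move=> x Dx /=; rewrite normrM (ger0_norm (w0 _ Dx)) ler_wpM2r ?fM// w0.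
Qed.

End bounded_mul.

Section quadrature.
Local Open Scope classical_set_scope.
Context {R : realType}.
Notation mu := (@lebesgue_measure R).
Implicit Types (a b e M : R) (J : nat) (D : set R) (f : R -> R).

Lemma horner_le_bound (p : {poly R}) x : `|x| <= 1 ->
  `|p.[x]| <= \sum_(i < size p) `|p`_i|.
Proof.
move=> x1; rewrite horner_coef (le_trans (ler_norm_sum _ _ _))// ler_sum// => i _.
by rewrite normrM normrX ler_piMr// exprn_ile1.
Qed.

Lemma measurable_horner D (p : {poly R}) : measurable_fun D (horner p).
Proof.
apply: (@measurable_funS _ _ _ _ setT) => //.
by apply: continuous_measurable_fun; exact: continuous_horner.
Qed.

Lemma jacobi_weight_ge0 a b x : 0 <= jacobi_weight a b x :> R.
Proof. by rewrite mulr_ge0 ?powR_ge0. Qed.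

Section gauss.
Context {a b : R} {J : nat} {xi om : 'I_J -> R}.
Hypothesis gj : gauss_jacobi a b xi om.

(** The rule is exact on the square of the nodal polynomial without its factor at [xi j], which has
    degree [2J - 2]. The sum reduces to its term [j], and the integral is nonnegative. *)
Lemma gauss_weight_ge0 j : 0 <= om j.
Proof.
have [xi1 xi_inj ex] := gj.
pose s := rem j (enum 'I_J).
pose q : {poly R} := \prod_(i <- s) ('X - (xi i)%:P).
have J0 : (0 < J)%N by rewrite (leq_trans _ (ltn_ord j)).
have sq : size q = J.
  rewrite size_prod_XsubC size_rem ?mem_enum// -cardE card_ord.
  by rewrite prednK.
have qE i : q.[xi i] = 0 <-> i != j.
  have := root_prod_XsubC [seq xi i | i <- s] (xi i).
  rewrite big_map -/q /root mem_map// /s mem_rem_uniq ?enum_uniq// inE mem_enum.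
  by rewrite andbT => qi; split=> [/eqP|ij]; [rewrite qi|apply/eqP; rewrite qi].
have := ex (q ^+ 2) => /(_ _)/wrap[|qint].
  by rewrite expr2 (leq_trans (size_polyMleq _ _))// sq; lia.
have : 0 <= \sum_(i < J) om i * (q ^+ 2).[xi i].
  rewrite -qint; apply: Rintegral_ge0 => x _.
  by rewrite mulr_ge0 ?jacobi_weight_ge0// horner_exp sqr_ge0.
rewrite (bigD1 j)//= big1 ?addr0 => [|i /qE qi]; last first.
  by rewrite horner_exp qi expr0n mulr0.
rewrite horner_exp pmulr_lge0// exprn_even_gt0//=.
by apply/eqP => /qE; rewrite eqxx.
Qed.

Lemma gauss_weight_sum : (0 < J)%N ->
  \sum_(j < J) om j = \int[mu]_(x in `]-1, 1[) jacobi_weight a b x.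
Proof.
move=> J0; have [_ _ /(_ 1)] := gj.
rewrite size_poly1 => /(_ (ltac:(lia)))/esym.
under eq_Rintegral do rewrite hornerC mul1r.
by move <-; apply: eq_bigr => j _; rewrite hornerC mulr1.
Qed.

(** Exactness on [p] leaves the integral and the quadrature sum of [f - p]. Each is at most [e]
    times the mass of the weight, since the quadrature weights are nonnegative and sum to that
    mass. *)
Lemma gauss_error f (p : {poly R}) e : (0 < J)%N ->
  mu.-integrable (`]-1, 1[ : set R) (EFin \o jacobi_weight a b) ->
  measurable_fun (`]-1, 1[ : set R) f -> (size p <= 2 * J)%N ->
  (forall x : R, -1 <= x <= 1 -> `|f x - p.[x]| <= e) ->
  `|\int[mu]_(x in `]-1, 1[) (f x * jacobi_weight a b x) -
    \sum_(j < J) om j * f (xi j)| <=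
  2 * e * \int[mu]_(x in `]-1, 1[) jacobi_weight a b x.
Proof.
move=> J0 iw mf sp fp; have [xi1 _ /(_ _ sp) ex] := gj.
set w := jacobi_weight a b in iw ex *.
have w0 (x : R) : `]-1, 1[%classic x -> 0 <= w x by move=> _; exact: jacobi_weight_ge0.
have mp : measurable_fun (`]-1, 1[ : set R) (horner p).
  exact: measurable_horner.
have mfp : measurable_fun (`]-1, 1[ : set R) (fun x => f x - p.[x]).
  exact: measurable_funB.
have fp' (x : R) : `]-1, 1[%classic x -> `|f x - p.[x]| <= e.
  by rewrite /= in_itv/= => /andP[x0 x1]; apply: fp; rewrite !ltW.
have pM (x : R) : `]-1, 1[%classic x -> `|p.[x]| <= \sum_(i < size p) `|p`_i|.
  rewrite /= in_itv/= => /andP[x0 x1]; apply: horner_le_bound.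
  by rewrite ler_norml !ltW.
have ifp := integrable_bounded_mul iw (measurable_itv _) mfp w0 fp'.
have ip := integrable_bounded_mul iw (measurable_itv _) mp w0 pM.
have -> : \int[mu]_(x in `]-1, 1[) (f x * w x) =
    \int[mu]_(x in `]-1, 1[) ((f x - p.[x]) * w x) +
    \int[mu]_(x in `]-1, 1[) (p.[x] * w x).
  rewrite -RintegralD//.
  by apply: eq_Rintegral => x _; rewrite -mulrDl subrK.
rewrite ex -addrA -sumrB (le_trans (ler_normD _ _))//.
rewrite -[2 * e * _]mulrA mulr_natl mulr2n lerD//.
  exact: le_Rintegral_bounded_mul.
rewrite -gauss_weight_sum// mulr_sumr (le_trans (ler_norm_sum _ _ _))//.
apply: ler_sum => j _; rewrite -mulrBr normrM (ger0_norm (gauss_weight_ge0 j)).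
rewrite mulrC ler_wpM2r ?gauss_weight_ge0// distrC fp//.
by have /andP[x0 x1] := xi1 j; rewrite !ltW.
Qed.

End gauss.
End quadrature.

(** * Dyadic decomposition of the gamma integral *)

Section affine_change.
Local Open Scope classical_set_scope.
Context {R : realType}.
Notation mu := (@lebesgue_measure R).
Implicit Types (r c a b : R) (D : set R) (f : R -> R).

(** By uniqueness of Lebesgue measure, it is enough to compare both sides on half-open intervals. *)
Lemma lebesgue_measure_affine r c (D : set (measurableTypeR R)) : 0 < r ->
  measurable D ->
  mu D = (r%:E * mu ((fun x => (r * x + c)%R) @^-1` D))%E.
Proof.
move=> r0 mD; pose phi : measurableTypeR R -> measurableTypeR R :=
  fun x : R => (r * x + c)%R.
have mphi : measurable_fun setT phi.
  by apply: measurable_funD => //; exact: measurable_funM.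
have rn : 0 <= r by exact: ltW.
pose nu := mscale (NngNum rn) (pushforward mu phi).
transitivity (nu mphi D); last by [].
apply: lebesgue_measure_unique => // _ [[a b]] _ <-.
change (mu `]a, b] = r%:E * mu (phi @^-1` `]a, b]))%E.
have -> : phi @^-1` `]a, b] = `](a - c) / r, (b - c) / r]%classic.
  apply/seteqP; split => x /=; rewrite /phi !in_itv/= ltr_pdivrMr// ler_pdivlMr//.
    by rewrite ltrBlDr lerBrDr mulrC.
  by rewrite ltrBlDr lerBrDr mulrC.
rewrite !lebesgue_measure_itv/= !lte_fin ltr_pM2r ?invr_gt0// ltrD2r.
case: ifP => _; last by rewrite mule0.
by rewrite -!EFinB -EFinM; congr EFin; field; rewrite gt_eqF.
Qed.

Lemma ge0_integral_affine r c (D : set R) (f : R -> R) : 0 < r ->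
  measurable D -> measurable_fun D f -> (forall x, D x -> 0 <= f x) ->
  (\int[mu]_(x in D) (f x)%:E =
   r%:E * \int[mu]_(x in (fun x => r * x + c)%R @^-1` D) (f (r * x + c)%R)%:E)%E.
Proof.
move=> r0 mD mf f0; pose phi : measurableTypeR R -> measurableTypeR R :=
  fun x : R => (r * x + c)%R.
have mphi : measurable_fun setT phi.
  by apply: measurable_funD => //; exact: measurable_funM.
have rn : 0 <= r by exact: ltW.
have mfE : measurable_fun D (EFin \o f) by exact/measurable_EFinP.
have fE0 x : D x -> (0 <= (EFin \o f) x)%E by move=> /f0; rewrite lee_fin.
rewrite -(ge0_integral_pushforward mphi mu mD mfE); last first.
  by move=> x /[!inE]; exact: fE0.
have := ge0_integral_mscale (pushforward mu phi) mD (NngNum rn) mfE fE0.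
move=> /= <-.
by apply: eq_measure_integral => A mA _; exact: lebesgue_measure_affine.
Qed.

Lemma integrable_affine r c (D : set R) (f : R -> R) : 0 < r ->
  measurable D -> mu.-integrable D (EFin \o f) ->
  mu.-integrable ((fun x => r * x + c) @^-1` D)
    (EFin \o (fun x => f (r * x + c))).
Proof.
move=> r0 mD /integrableP[/measurable_EFinP mf fi].
have mphi : measurable_fun [set: R] (fun x : R => (r * x + c)%R).
  by apply: measurable_funD => //; exact: measurable_funM.
apply/integrableP; split.
  apply/measurable_EFinP; apply: (measurable_comp mD) => //.
    by move=> _ [x Dx <-].
  exact: measurable_funTS.
have := @ge0_integral_affine r c D (fun x => `|f x|) r0 mD.
move=> /(_ _ _)/wrap[||fE]; [exact: measurableT_comp|by []|].
move: fi; rewrite /= fE.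
set I := (X in (_ * X < _)%E -> _); have I0 : (0 <= I)%E by exact: integral_ge0.
have [//|] := ltP I +oo%E; rewrite leye_eq => /eqP ->.
by rewrite gt0_muley ?lte_fin.
Qed.

Lemma Rintegral_ge0_affine r c (D : set R) (f : R -> R) : 0 < r ->
  measurable D -> mu.-integrable D (EFin \o f) -> (forall x, D x -> 0 <= f x) ->
  \int[mu]_(x in D) f x =
  r * \int[mu]_(x in (fun x => r * x + c) @^-1` D) f (r * x + c).
Proof.
move=> r0 mD fi f0; have ifc := integrable_affine c r0 mD fi.
have mphi : measurable_fun [set: R] (fun x : R => (r * x + c)%R).
  by apply: measurable_funD => //; exact: measurable_funM.
have mf : measurable_fun D f by apply/measurable_EFinP; exact: measurable_int fi.
rewrite /Rintegral (ge0_integral_affine c r0 mD mf f0) fineM//.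
apply: integrable_fin_num ifc.
by rewrite -[X in measurable X]setTI; exact: mphi.
Qed.

End affine_change.

(** * Integrability and dyadic estimates for the gamma density *)

Section gamma_density.
Local Open Scope classical_set_scope.
Context {R : realType}.
Notation mu := (@lebesgue_measure R).
Implicit Types (alpha lam a b x s : R).

Definition gdens alpha s := s `^ (- alpha) * expR (- s).

Lemma gdens_ge0 alpha s : 0 <= gdens alpha s.
Proof. by rewrite mulr_ge0 ?powR_ge0 ?expR_ge0. Qed.

Lemma measurable_powRN alpha D : measurable_fun D (fun s : R => s `^ (- alpha)).
Proof. exact: measurable_funTS. Qed.

Lemma measurable_gdens alpha (D : set R) : measurable_fun D (gdens alpha).
Proof.
apply: measurable_funM; first exact: measurable_powRN.
apply: measurable_funTS; apply: measurableT_comp => //.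
Qed.

(** Monotone convergence along the intervals [[1 / (n + 1), 1]], on which the antiderivative bounds
    the integral by [1 / (1 - alpha)]. *)
Lemma integrable_powRN_itv01 alpha : alpha < 1 ->
  mu.-integrable (`]0, 1] : set R) (EFin \o (fun s => s `^ (- alpha))).
Proof.
move=> a1; have b0 : 0 < 1 - alpha by lra.
pose F n := (`[n.+1%:R^-1, 1]%classic : set R).
have F0 n : 0 < n.+1%:R^-1 :> R by rewrite invr_gt0.
have FE n x : F n x <-> n.+1%:R^-1 <= x <= 1 by rewrite /F /mkset in_itv.
have FU : `]0, 1]%classic = \bigcup_n F n.
  apply/seteqP; split => [x|x [n _ /FE/andP[nx x1]]].
    rewrite /= in_itv/= => /andP[x0 x1]; have [n nx] := ltr_add_invr x0.
    by exists n => //; apply/FE; rewrite x1 andbT ltW// -[_^-1]add0r.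
  by rewrite /= in_itv/= x1 andbT (lt_le_trans (F0 n)).
apply/integrableP; split.
  by apply/measurable_EFinP; exact: measurable_powRN.
under eq_integral do rewrite /= ger0_norm ?powR_ge0//.
rewrite FU.
have cv := @ge0_nondecreasing_set_cvg_integral _ (measurableTypeR R) R F
  (fun s => (s `^ (- alpha))%:E) mu.
apply: (@le_lt_trans _ _ (1 - alpha)^-1%:E); last exact: ltry.
move: cv => /(_ _ _ _ _)/wrap[||||cv].
- move=> m n mn; rewrite subsetEset => x /FE/andP[mx x1]; apply/FE.
  by rewrite x1 andbT (le_trans _ mx)// lef_pV2 ?posrE// ler_nat.
- by move=> n; exact: measurable_itv.
- by move=> n; apply/measurable_EFinP; exact: measurable_powRN.
- by move=> n x _; rewrite lee_fin powR_ge0.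
rewrite -(cvg_lim _ cv)//; apply: lime_le; first exact: cvgP cv.
(* For [n = 0] the interval is the single point 1, where the fundamental theorem of calculus does
   not apply. *)
apply: nearW => -[|n].
  by rewrite /F invr1 set_itv1 integral_set1 lee_fin invr_ge0 ltW.
pose G s := (1 - alpha)^-1 * s `^ (1 - alpha).
have n1 : n.+2%:R^-1 < 1 :> R by rewrite invf_lt1// ltr1n.
have dG (x : R) : 0 < x -> is_derive x (1 : R) G (x `^ (- alpha)).
  move=> x0; apply: (@trigger_derive _ G _ _ _
    (is_deriveZ (1 - alpha)^-1 (is_derive1_powR (1 - alpha) x0))).
  rewrite /GRing.scale/= mulKf ?gt_eqF//.
  by rewrite addrAC subrr add0r.
have cG (x : R) : 0 < x -> {for x, continuous G}.
  move=> x0; apply/differentiable_continuous/derivable1_diffP.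
  by have [] := dG _ x0.
rewrite (@continuous_FTC2 _ _ G)//.
- rewrite -EFinB lee_fin /G powR1 mulr1 lerBlDr lerDl mulr_ge0 ?powR_ge0//.
  by rewrite invr_ge0 ltW.
- apply: derivable_within_continuous => x; rewrite in_itv/= => /andP[nx _].
  by apply: ex_derive; apply: is_derive1_powR; rewrite (lt_le_trans (F0 n.+1)).
- split.
  + move=> x; rewrite in_itv/= => /andP[nx _].
    by have [] := dG _ (lt_trans (F0 n.+1) nx).
  + by apply: cvg_at_right_filter; exact: cG.
  + by apply: cvg_at_left_filter; exact: cG.
- move=> x; rewrite in_itv/= => /andP[nx _]; rewrite derive1E.
  by have [_ ->] := dG _ (lt_trans (F0 n.+1) nx).
Qed.

(** The density is dominated by [s^(-alpha)] up to 1 and by the exponential density beyond 1. *)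
Lemma integrable_gdens alpha : 0 < alpha < 1 ->
  mu.-integrable (`]0, +oo[ : set R) (EFin \o gdens alpha).
Proof.
move=> /andP[a0 a1].
have mG D : measurable_fun D (EFin \o gdens alpha).
  by apply/measurable_EFinP; exact: measurable_gdens.
have i1 : mu.-integrable (`]0, 1] : set R) (EFin \o gdens alpha).
  apply: (le_integrable _ _ _ (integrable_powRN_itv01 a1)) => [//||x].
    exact: mG.
  rewrite /= in_itv/= => /andP[x0 _]; rewrite lee_fin.
  rewrite !ger0_norm ?gdens_ge0 ?powR_ge0// ler_piMr ?powR_ge0//.
  by rewrite expR_le1 lerNl oppr0 ltW.
have i2 : mu.-integrable (`]1, +oo[ : set R) (EFin \o gdens alpha).
  have ie : mu.-integrable (`]1, +oo[ : set R) (EFin \o exponential_pdf 1).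
    exact: integrableS (integrable_exponential_pdf ltr01).
  apply: (le_integrable _ _ _ ie) => [//||x]; first exact: mG.
  rewrite /= in_itv/= andbT => x1.
  have x0 : 0 <= x by rewrite (le_trans ler01)// ltW.
  rewrite exponential_pdfE// lee_fin mul1r mulN1r.
  rewrite !ger0_norm ?gdens_ge0 ?expR_ge0// ler_piMl ?expR_ge0//.
  have := ler_powR (ltW x1) (ltac:(lra) : - alpha <= 0).
  by rewrite powRr0.
have -> : `]0, +oo[%classic = (`]0, 1] : set R) `|` `]1, +oo[.
  apply/seteqP; split => [x|x []]; rewrite /= !in_itv/= ?andbT.
  - by move=> x0; have [x1|x1] := leP x 1; [left; rewrite x0|right].
  - by move=> /andP[].
  - by apply: lt_trans.
apply/integrableP; split; first exact: mG.
rewrite ge0_integral_setU//=.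
- apply: lte_add_pinfty; first by case/integrableP: i1.
  by case/integrableP: i2.
- by apply/measurable_EFinP; apply: measurableT_comp => //; exact: measurable_gdens.
- apply/disj_setPS => x [/=]; rewrite !in_itv/= andbT => /andP[_ x1] x1'.
  by move: x1; rewrite leNgt x1'.
Qed.

Lemma integrable_gdensS alpha (D : set R) : 0 < alpha < 1 -> measurable D ->
  D `<=` `]0, +oo[ -> mu.-integrable D (EFin \o gdens alpha).
Proof. by move=> a01 mD D0; exact: integrableS (integrable_gdens a01). Qed.

Lemma GammaE alpha : Gamma (1 - alpha) = \int[mu]_(s in `]0, +oo[) gdens alpha s.
Proof. by apply: eq_Rintegral => s _; rewrite addrAC subrr add0r. Qed.

Lemma upper_GammaE alpha x :
  upper_Gamma (1 - alpha) x = \int[mu]_(s in `]x, +oo[) gdens alpha s.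
Proof. by apply: eq_Rintegral => s _; rewrite addrAC subrr add0r. Qed.

Lemma Rintegral_gdens_split alpha a b : 0 < alpha < 1 -> 0 <= a <= b ->
  \int[mu]_(s in `]a, +oo[) gdens alpha s =
  \int[mu]_(s in `]a, b[) gdens alpha s + \int[mu]_(s in `]b, +oo[) gdens alpha s.
Proof.
move=> a01 /andP[a0 ab].
have sub (i : interval R) : (BRight 0 <= i.1)%O ->
    [set` i] `<=` (`]0, +oo[ : set R).
  by case: i => i1 i2 /= i0; apply: subset_itv => //; case: i2 => //= -[].
rewrite -(@Rintegral_itvB _ (gdens alpha) (BRight a) +oo%O b)//; last first.
  by apply: integrable_gdensS => //; apply: sub.
rewrite -Rintegral_itv_bndo_bndc; last by apply: integrable_gdensS => //; apply: sub.
by rewrite addrC subrK.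
Qed.

Lemma Rintegral_gdens_dyadic alpha a K : 0 < alpha < 1 -> 0 < a ->
  Gamma (1 - alpha) = \int[mu]_(s in `]0, a[) gdens alpha s +
    \sum_(k < K) \int[mu]_(s in `]a * 2 ^+ k, a * 2 ^+ k.+1[) gdens alpha s +
    upper_Gamma (1 - alpha) (a * 2 ^+ K).
Proof.
move=> a01 a0; rewrite GammaE upper_GammaE.
rewrite (@Rintegral_gdens_split alpha 0 a)//; last by rewrite lexx ltW.
rewrite -addrA; congr (_ + _); elim: K => [|K IH].
  by rewrite big_ord0 add0r expr0 mulr1.
rewrite IH big_ord_recr/= -addrA; congr (_ + _).
rewrite (@Rintegral_gdens_split alpha (a * 2 ^+ K) (a * 2 ^+ K.+1))//.
apply/andP; split; first by rewrite mulr_ge0 ?exprn_ge0// ltW.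
by rewrite ler_pM2l// exprS ler_peMl ?exprn_ge0// ler1n.
Qed.

Lemma upper_Gamma_le alpha a b : 0 < alpha < 1 -> 0 <= a <= b ->
  upper_Gamma (1 - alpha) b <= upper_Gamma (1 - alpha) a.
Proof.
move=> a01 ab; rewrite !upper_GammaE (Rintegral_gdens_split a01 ab) lerDr.
by apply: Rintegral_ge0 => x _; exact: gdens_ge0.
Qed.

(** The density decreases, so the integral is at least the length [a] times the value at [2 a],
    which is half of the left-hand side. *)
Lemma powR_exp_le_Rintegral_gdens alpha a : 0 < alpha < 1 -> 0 < a ->
  (2 * a) `^ (1 - alpha) * expR (- (2 * a)) <=
  2 * \int[mu]_(s in `]a, 2 * a[) gdens alpha s.
Proof.
move=> a01 a0; have /andP[al0 al1] := a01.
pose c := gdens alpha (2 * a).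
have sub : `]a, 2 * a[ `<=` (`]0, +oo[ : set R).
  by apply: subset_itv => //; rewrite bnd_simp ltW.
have ic : mu.-integrable (`]a, 2 * a[ : set R) (EFin \o cst c).
  apply/integrableP; split; first exact/measurable_EFinP.
  have := @integral_cst _ (measurableTypeR R) R mu `]a, 2 * a[ (measurable_itv _).
  move=> /(_ `|c|%:E) /= ->; rewrite lebesgue_measure_itv/= lte_fin.
  by case: ifP => _; rewrite ?mule0 ?ltry// -EFinB -EFinM ltry.
have ig := integrable_gdensS a01 (measurable_itv _) sub.
have : \int[mu]_(s in `]a, 2 * a[) c <= \int[mu]_(s in `]a, 2 * a[) gdens alpha s.
  apply: le_Rintegral => // s; rewrite /= in_itv/= => /andP[sa sa2].
  have s0 : 0 < s by rewrite (lt_trans a0).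
  rewrite /c /gdens ler_pM ?powR_ge0 ?expR_ge0//.
    rewrite !powRN lef_pV2 ?posrE ?powR_gt0 ?mulr_gt0//.
    by apply: ge0_ler_powR; rewrite ?nnegrE ?ltW ?mulr_gt0.
  by rewrite ler_expR lerN2 ltW.
rewrite Rintegral_cst//; set m := fine _ => h.
have mE : m = a.
  rewrite /m /= lebesgue_measure_itv/= lte_fin ifT; last by lra.
  by rewrite -EFinB/=; lra.
rewrite {}mE in h.
rewrite (le_trans _ (ler_wpM2l (ler0n _ 2) h))//.
rewrite /c /gdens powRD; last by apply/implyP => _; rewrite gt_eqF ?mulr_gt0.
rewrite powRr1; last by rewrite mulr_ge0// ltW.
by rewrite le_eqVlt; apply/orP; left; apply/eqP; ring.
Qed.

(** The dyadic piece between [1 / 2] and 1 already has a positive integral. *)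
Lemma Gamma_gt0 alpha : 0 < alpha < 1 -> 0 < Gamma (1 - alpha) :> R.
Proof.
move=> a01; have h0 : 0 < 1 / 2 :> R by lra.
rewrite (Rintegral_gdens_dyadic 1 a01 h0) big_ord1 expr0 mulr1 expr1.
rewrite upper_GammaE ltr_wpDr ?Rintegral_ge0//; first by move=> *; exact: gdens_ge0.
rewrite ltr_wpDl ?Rintegral_ge0//; first by move=> *; exact: gdens_ge0.
have := powR_exp_le_Rintegral_gdens a01 h0; rewrite [_ / 2 * 2]mulrC.
have : 0 < (2 * (1 / 2)) `^ (1 - alpha) * expR (- (2 * (1 / 2))) :> R.
  by rewrite mulr_gt0 ?expR_gt0 ?powR_gt0//; lra.
by move=> /lt_le_trans/[apply]; rewrite pmulr_rgt0.
Qed.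

Lemma sum_powR_exp_dyadic_le alpha a K : 0 < alpha < 1 -> 0 < a ->
  \sum_(k < K) (a * 2 ^+ k) `^ (1 - alpha) * expR (- (a * 2 ^+ k)) <=
  2 * Gamma (1 - alpha).
Proof.
(* Starting the decomposition at [a / 2] makes [a 2^k] the right endpoint of piece [k]. *)
move=> a01 a0; have h0 : 0 < a / 2 by lra.
rewrite (Rintegral_gdens_dyadic K a01 h0) -addrA mulrDr.
rewrite ler_wpDl ?mulr_ge0 ?Rintegral_ge0//; first by move=> *; exact: gdens_ge0.
rewrite mulrDr ler_wpDr//.
  by rewrite mulr_ge0// upper_GammaE Rintegral_ge0// => *; exact: gdens_ge0.
rewrite mulr_sumr ler_sum// => k _.
have ak : 0 < a / 2 * 2 ^+ k by rewrite mulr_gt0 ?exprn_gt0.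
have := powR_exp_le_Rintegral_gdens a01 ak.
have -> : 2 * (a / 2 * 2 ^+ k) = a * 2 ^+ k by field.
by have -> : a / 2 * 2 ^+ k.+1 = a * 2 ^+ k by rewrite exprS; field.
Qed.

End gamma_density.

(** * Errors on the dyadic pieces *)

Section quadrature_pieces.
Local Open Scope classical_set_scope.
Context {R : realType}.
Notation mu := (@lebesgue_measure R).
Implicit Types (alpha lam x : R) (K J : nat).

Lemma affine_preimage_itv lam c : 0 < lam ->
  (fun x => lam * x + lam * c) @^-1` `]lam * (c - 1), lam * (c + 1)[ =
  `]-1, 1[%classic :> set R.
Proof.
move=> l0; apply/seteqP; split => x; rewrite /= !in_itv/= -mulrDr !ltr_pM2l//;
  by move=> /andP[? ?]; apply/andP; split; lra.
Qed.

(** The substitution [s = lam (x + c)], used with [c = 1] for the first piece and [c = 3] for the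
    others; [1 <= c] keeps the interval on the positive side. *)
Lemma Rintegral_gdens_affine alpha lam c : 0 < alpha < 1 -> 0 < lam -> 1 <= c ->
  \int[mu]_(s in `]lam * (c - 1), lam * (c + 1)[) gdens alpha s =
  lam `^ (1 - alpha) *
    \int[mu]_(x in `]-1, 1[) ((x + c) `^ (- alpha) * expR (- (lam * (x + c)))) /\
  mu.-integrable (`]-1, 1[ : set R)
    (EFin \o (fun x => (x + c) `^ (- alpha) * expR (- (lam * (x + c))))).
Proof.
move=> a01 l0 c1; have /andP[a0 a1] := a01.
have sub : `]lam * (c - 1), lam * (c + 1)[ `<=` (`]0, +oo[ : set R).
  by apply: subset_itv => //; rewrite bnd_simp mulr_ge0 ?(ltW l0)//; lra.
have ig := integrable_gdensS a01 (measurable_itv _) sub.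
have gE (x : R) : `]-1, 1[%classic x -> gdens alpha (lam * x + lam * c) =
    lam `^ (- alpha) * ((x + c) `^ (- alpha) * expR (- (lam * (x + c)))).
  rewrite /= in_itv/= => /andP[x1 _].
  rewrite /gdens -mulrDr powRM ?(ltW l0)//; first by rewrite mulrA.
  by lra.
have la0 : 0 < lam `^ (- alpha) by rewrite powR_gt0.
have := integrable_affine (lam * c) l0 (measurable_itv _) ig.
rewrite affine_preimage_itv// => iga.
have ik : mu.-integrable (`]-1, 1[ : set R)
    (EFin \o (fun x => (x + c) `^ (- alpha) * expR (- (lam * (x + c))))).
  have := @integrableZl _ (measurableTypeR R) R mu _ (measurable_itv _)
    (lam `^ (- alpha))^-1 _ iga.
  apply: eq_integrable => // x /[!inE] x1; rewrite /= gE// -EFinM; congr EFin.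
  by rewrite mulKf// gt_eqF.
split => //.
rewrite (Rintegral_ge0_affine (lam * c) l0 (measurable_itv _) ig); last first.
  by move=> x _; exact: gdens_ge0.
have -> : lam `^ (1 - alpha) = lam * lam `^ (- alpha).
  by rewrite powRD ?powRr1 ?(ltW l0)// (gt_eqF l0) implybT.
rewrite affine_preimage_itv// -mulrA.
congr (_ * _); rewrite -RintegralZl//.
by apply: eq_Rintegral => x /[!inE] x1; rewrite gE.
Qed.

Lemma jacobi_weight0 b x : jacobi_weight 0 b x = (1 + x) `^ b.
Proof. by rewrite /jacobi_weight powRr0 mul1r. Qed.

Lemma jacobi_weight00 x : jacobi_weight 0 0 x = 1.
Proof. by rewrite jacobi_weight0 powRr0. Qed.

Lemma integrable_jacobi_weight00 :
  mu.-integrable (`]-1, 1[ : set R) (EFin \o jacobi_weight 0 0).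
Proof.
have -> : EFin \o jacobi_weight 0 0 = EFin \o (cst 1 : R -> R).
  by apply/funext => x /=; rewrite jacobi_weight00.
apply/integrableP; split; first exact/measurable_EFinP.
have := @integral_cst _ (measurableTypeR R) R mu `]-1, 1[ (measurable_itv _).
move=> /(_ `|1|%:E) /= ->; rewrite lebesgue_measure_itv/= lte_fin.
by case: ifP => _; rewrite ?mule0 ?ltry// -EFinB -EFinM ltry.
Qed.

Lemma Rintegral_jacobi_weight00 :
  \int[mu]_(x in `]-1, 1[) jacobi_weight 0 0 x = 2.
Proof.
rewrite (_ : jacobi_weight 0 0 = cst 1); last first.
  by apply/funext => x; rewrite jacobi_weight00.
rewrite Rintegral_cst//= mul1r lebesgue_measure_itv/= lte_fin ifT; last by lra.
by rewrite -EFinB/=; lra.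
Qed.

Section errors.
Context {alpha lam : R} {J : nat} {xi om : 'I_J -> R}.
Hypotheses (a01 : 0 < alpha < 1) (l0 : 0 < lam) (J0 : (0 < J)%N).

Lemma measurable_kern D : measurable_fun D (kern alpha lam).
Proof.
apply: measurable_funTS; apply: measurable_funM.
  by apply: (measurableT_comp (measurable_powR (- alpha))); exact: measurable_funD.
apply: measurableT_comp => //; apply: measurableT_comp => //.
by apply: measurable_funM => //; exact: measurable_funD.
Qed.

Lemma legendre_error : gauss_jacobi 0 0 xi om ->
  `|\int[mu]_(s in `]2 * lam, 4 * lam[) gdens alpha s -
    lam `^ (1 - alpha) * \sum_(j < J) om j * kern alpha lam (xi j)| <=
  40 * AJ J * ((lam / (2 * J%:R)) `^ (1 - alpha) * expR (- (lam / (2 * J%:R)))).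
Proof.
move=> gj; have /andP[a0 a1] := a01.
have c1 : 1 <= 3 :> R by lra.
have [] := Rintegral_gdens_affine a01 l0 c1.
have -> : lam * (3 - 1) = 2 * lam by ring.
have -> : lam * (3 + 1) = 4 * lam by ring.
move=> -> _; rewrite -mulrBr normrM ger0_norm ?powR_ge0//.
have [p sp pP] := kern_approx J0 (ltW a0) (ltW l0).
have mk : measurable_fun (`]-1, 1[ : set R) (kern alpha lam).
  exact: measurable_kern.
have := gauss_error gj J0 integrable_jacobi_weight00 mk sp pP.
rewrite Rintegral_jacobi_weight00.
have -> : \int[mu]_(x in `]-1, 1[) (kern alpha lam x * jacobi_weight 0 0 x) =
    \int[mu]_(x in `]-1, 1[) ((x + 3) `^ (- alpha) * expR (- (lam * (x + 3)))).
  by apply: eq_Rintegral => x _; rewrite jacobi_weight00 mulr1.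
have la0 : 0 <= lam `^ (1 - alpha) by rewrite powR_ge0.
move=> /(ler_wpM2l la0)/le_trans; apply.
have J1 : 0 < 2 * J%:R :> R by rewrite mulr_gt0// ltr0n.
have -> : (lam / (2 * J%:R)) `^ (1 - alpha) =
    lam `^ (1 - alpha) * ((2 * J%:R) `^ alpha / (2 * J%:R)).
  rewrite powRM ?invr_ge0 ?ltW//; congr (_ * _).
  rewrite -powR_inv1 ?(ltW J1)// -powRrM mulN1r opprB powRD.
    by rewrite powRN powRr1// ltW.
  by rewrite (gt_eqF J1) implybT.
(* The constant is [2 * 5 * 2 = 20], from [gauss_error], [kern_approx] and the mass 2 of the weight.
   Rewriting [(2J)^alpha] as [2J (2J)^(alpha - 1)] turns 20 into [40 J], which is where the factor
   [J] of [AJ] arises. *)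
rewrite /AJ -/(rho (R := R)) le_eqVlt; apply/orP; left; apply/eqP; field.
by rewrite gt_eqF ?ltr0n ?expf_neq0// gt_eqF// (lt_le_trans _ rho_ge).
Qed.

(** The singular factor [(x + 1)^(-alpha)] is the quadrature weight, so only the exponential has to
    be approximated. The factor [e^2] combines the shift from [x + 3] to [x + 1] with the comparison
    of the weight to the gamma density. *)
Lemma first_error : lam <= 2^-1 -> gauss_jacobi 0 (- alpha) xi om ->
  `|\int[mu]_(s in `]0, 2 * lam[) gdens alpha s -
    lam `^ (1 - alpha) * \sum_(j < J) om j * expR (- (lam * (xi j + 1)))| <=
  10 * expR 1 ^+ 2 * AJ J * Gamma (1 - alpha).
Proof.
move=> l1 gj; have /andP[a0 a1] := a01.
have [] := Rintegral_gdens_affine a01 l0 (lexx 1).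
have -> : lam * (1 - 1) = 0 by ring.
have -> : lam * (1 + 1) = 2 * lam by ring.
set f := fun x : R => expR (- (lam * (x + 1))).
have -> : \int[mu]_(x in `]-1, 1[) ((x + 1) `^ (- alpha) * expR (- (lam * (x + 1)))) =
    \int[mu]_(x in `]-1, 1[) (f x * jacobi_weight 0 (- alpha) x).
  by apply: eq_Rintegral => x _; rewrite jacobi_weight0 [1 + x]addrC mulrC.
have -> : (fun x => (x + 1) `^ (- alpha) * expR (- (lam * (x + 1)))) =
    fun x => f x * jacobi_weight 0 (- alpha) x.
  by apply/funext => x; rewrite jacobi_weight0 mulrC [1 + x]addrC.
move=> IE ifw.
have mE (c : R) D : measurable_fun D (fun x : R => expR (c * (lam * (x + 1)))).
  apply: measurable_funTS; apply: measurableT_comp => //.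
  apply: measurable_funM => //; apply: measurable_funM => //.
  exact: measurable_funD.
have fE : f = fun x : R => expR (-1 * (lam * (x + 1))).
  by apply/funext => x; rewrite mulN1r.
(* Writing the weight as the rescaled gamma density times a factor at most [e] yields both its
   integrability and a bound on its mass. *)
have wE (x : R) : jacobi_weight 0 (- alpha) x =
    expR (1 * (lam * (x + 1))) * (f x * jacobi_weight 0 (- alpha) x).
  by rewrite mulrA /f mul1r -expRD subrr expR0 mul1r.
have w0 (x : R) : 0 <= jacobi_weight 0 (- alpha) x by exact: jacobi_weight_ge0.
have fw0 (x : R) : `]-1, 1[%classic x -> 0 <= f x * jacobi_weight 0 (- alpha) x.
  by move=> _; rewrite mulr_ge0// expR_ge0.
have eM (x : R) : `]-1, 1[%classic x -> `|expR (1 * (lam * (x + 1)))| <= expR 1.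
  rewrite /= in_itv/= => /andP[x1 x2]; rewrite ger0_norm ?expR_ge0// ler_expR.
  nra.
have iw : mu.-integrable (`]-1, 1[ : set R) (EFin \o jacobi_weight 0 (- alpha)).
  rewrite (_ : jacobi_weight 0 (- alpha) = fun x => expR (1 * (lam * (x + 1))) *
      (f x * jacobi_weight 0 (- alpha) x)); last exact/funext.
  exact: integrable_bounded_mul ifw (measurable_itv _) (mE _ _) fw0 eM.
have la0 : 0 <= lam `^ (1 - alpha) by rewrite powR_ge0.
have mass : lam `^ (1 - alpha) *
    \int[mu]_(x in `]-1, 1[) jacobi_weight 0 (- alpha) x <=
    expR 1 * Gamma (1 - alpha).
  have -> : \int[mu]_(x in `]-1, 1[) jacobi_weight 0 (- alpha) x =
    \int[mu]_(x in `]-1, 1[) (expR (1 * (lam * (x + 1))) *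
      (f x * jacobi_weight 0 (- alpha) x)).
    by apply: eq_Rintegral => x _; exact: wE.
  have := le_Rintegral_bounded_mul ifw (measurable_itv _) (mE _ _) fw0 eM.
  move=> /(le_trans (ler_norm _))/(ler_wpM2l la0)/le_trans; apply.
  rewrite mulrCA ler_wpM2l ?expR_ge0// -IE.
  have l20 : 0 < 2 * lam by rewrite mulr_gt0.
  rewrite (Rintegral_gdens_dyadic 0 a01 l20) big_ord0 addr0 lerDl upper_GammaE.
  by apply: Rintegral_ge0 => s _; exact: gdens_ge0.
rewrite IE -mulrBr normrM ger0_norm//.
have [p sp pP] := kern_approx J0 (lexx 0) (ltW l0).
have rJ : 0 <= rho ^- (2 * J) :> R.
  by rewrite invr_ge0 exprn_ge0// (le_trans _ rho_ge).
(* The approximant of [kern 0 lam] is multiplied by [e^(2 lam) <= e]. *)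
have fp (x : R) : -1 <= x <= 1 ->
    `|f x - (expR (2 * lam) *: p).[x]| <= 5 * expR 1 * rho ^- (2 * J).
  move=> /pP; rewrite /kern oppr0 !powRr0 !mul1r => xp.
  have -> : f x = expR (2 * lam) * expR (- (lam * (x + 3))).
    by rewrite /f -expRD; congr expR; ring.
  rewrite hornerZ -mulrBr normrM ger0_norm ?expR_ge0//.
  have -> : 5 * expR 1 * rho ^- (2 * J) = expR 1 * (5 * rho ^- (2 * J)) :> R by ring.
  rewrite ler_pM ?expR_ge0//; first by rewrite ler_expR; lra.
  rewrite (le_trans xp)// ler_piMr ?mulr_ge0// expR_le1 oppr_le0.
  by rewrite divr_ge0 ?(ltW l0) ?mulr_ge0.
have mf : measurable_fun (`]-1, 1[ : set R) f by rewrite fE; exact: mE.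
have sp' : (size (expR (2 * lam) *: p) <= 2 * J)%N.
  exact: leq_trans (size_scale_leq _ _) sp.
have := gauss_error gj J0 iw mf sp' fp.
move=> /(ler_wpM2l la0)/le_trans; apply.
rewrite mulrCA.
have e0 : 0 <= 2 * (5 * expR 1 * rho ^- (2 * J)) :> R.
  by rewrite !mulr_ge0 ?expR_ge0.
rewrite (le_trans (ler_wpM2l e0 mass))// /AJ -/(rho (R := R)).
have J1 : 1 <= J%:R :> R by rewrite ler1n.
have G0 := Gamma_gt0 a01.
have eG0 : 0 <= 10 * expR 1 ^+ 2 * rho ^- (2 * J) * Gamma (1 - alpha).
  by rewrite !mulr_ge0 ?exprn_ge0 ?expR_ge0// ltW.
have := ler_wpM2l eG0 J1; rewrite mulr1; lra.

Qed.

End errors.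
End quadrature_pieces.

(** * The exponential sum as a quadrature of the gamma integral *)

Section exponential_sum.
Context {R : realType}.
Implicit Types (alpha T delta t : R).

Lemma radiusE T k : Defs.radius T k.+1 = (2 * T)^-1 * 2 ^+ k. Proof. by []. Qed.

Lemma radius_gt0 T k : 0 < T -> 0 < Defs.radius T k.
Proof.
by move=> T0; case: k => [|k]; rewrite ?radiusE ?mulr_gt0 ?invr_gt0 ?exprn_gt0 ?mulr_gt0.
Qed.

(** This extracts the factor [wker alpha tau], so that the error becomes relative; it rests on
    [tau^(-1 + alpha) tau^(1 - alpha) = 1]. *)
Lemma powR_wker alpha r tau : 0 < r -> 0 < tau ->
  Calpha alpha * r `^ (1 - alpha) =
  wker alpha tau / Gamma (1 - alpha) * (r * tau) `^ (1 - alpha).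
Proof.
move=> r0 t0; rewrite /Calpha /wker powRM ?ltW// invfM.
have E : tau `^ (-1 + alpha) * tau `^ (1 - alpha) = 1.
  rewrite -powRD; last by rewrite (gt_eqF t0) implybT.
  by rewrite (_ : _ + _ = 0) ?powRr0//; ring.
rewrite [LHS](_ : _ = (Gamma alpha)^-1 * (Gamma (1 - alpha))^-1 * r `^ (1 - alpha) *
  (tau `^ (-1 + alpha) * tau `^ (1 - alpha))); last by rewrite E mulr1.
ring.
Qed.

(** Since [e^(- delta a) e^(- a t) = e^(- a (t + delta))], the sum is a multiple of a quadrature of
    the integral of [Gamma (1 - alpha)], whose pieces have the parameters
    [radius T k * (t + delta)]. *)
Lemma expSE alpha delta T K J (xi0 om0 xi om : 'I_J -> R) t :
  0 < T -> 0 < t + delta -> (forall j, -1 < xi j < 1) ->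
  expS alpha delta T K xi0 om0 xi om t =
  wker alpha (t + delta) / Gamma (1 - alpha) *
  ((Defs.radius T 0 * (t + delta)) `^ (1 - alpha) *
    \sum_(j < J) om0 j * expR (- (Defs.radius T 0 * (t + delta) * (xi0 j + 1))) +
   \sum_(k < K) (Defs.radius T k.+1 * (t + delta)) `^ (1 - alpha) *
    \sum_(j < J) om j * kern alpha (Defs.radius T k.+1 * (t + delta)) (xi j)).
Proof.
move=> T0 td0 xi1; rewrite /expS big_ord_recl mulrDr; congr (_ + _).
  rewrite mulrA -powR_wker ?radius_gt0// mulr_sumr; apply: eq_bigr => j _.
  rewrite /bcoef /acoef /centre /Defs.radius /=; set r := (2 * T)^-1.
  have -> : expR (- (r * (t + delta) * (xi0 j + 1))) =
      expR (- (delta * (r * xi0 j + r))) * expR (- ((r * xi0 j + r) * t)).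
    by rewrite -expRD; congr expR; ring.
  ring.
rewrite mulr_sumr; apply: eq_bigr => k _.
have r0 := @radius_gt0 T k.+1 T0.
rewrite mulrA -powR_wker// mulr_sumr; apply: eq_bigr => j _.
rewrite /bcoef /acoef lift0 -/(Defs.radius T k.+1) /centre -/(Defs.radius T k.+1).
have -> : Defs.radius T k.+1 * xi j + 3 * Defs.radius T k.+1 = Defs.radius T k.+1 * (xi j + 3).
  by ring.
set r := Defs.radius T k.+1 in r0 *.
have x3 : 0 <= xi j + 3 by have := xi1 j; lra.
rewrite powRM ?(ltW r0)// /kern.
have -> : r `^ (1 - alpha) = r * r `^ (- alpha).
  by rewrite powRD ?powRr1 ?(ltW r0)// (gt_eqF r0) implybT.
have -> : expR (- (r * (t + delta) * (xi j + 3))) =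
    expR (- (delta * (r * (xi j + 3)))) * expR (- (r * (xi j + 3) * t)).
  by rewrite -expRD; congr expR; ring.
ring.
Qed.

End exponential_sum.

Theorem theorem4p1 (R : realType) :
  exists C : R, 0 < C /\
    forall (alpha T delta : R) (K J : nat) (xi0 om0 xi om : 'I_J -> R),
      0 < alpha < 1 -> 0 < T -> 0 < delta < T -> (1 <= J)%N ->
      gauss_jacobi 0 (- alpha) xi0 om0 ->
      gauss_jacobi 0 0 xi om ->
      forall t : R, 0 <= t <= T - delta ->
        `|wker alpha (t + delta) - expS alpha delta T K xi0 om0 xi om t|
        <= CKJ C K J alpha (delta / T) * wker alpha (t + delta).
Proof.
(* The pieces [k >= 1] contribute 80, as 40 from [legendre_error] times 2 from the dyadic sum;
   [first_error] contributes the rest. *)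
exists (80 + 10 * expR 1 ^+ 2); split.
  by rewrite addr_gt0// mulr_gt0// exprn_gt0// expR_gt0.
move=> alpha T delta K J xi0 om0 xi om a01 T0 /andP[d0 dT] J0 gj0 gj t /andP[t0 tT].
have td0 : 0 < t + delta by lra.
have [xi1 _ _] := gj.
rewrite expSE//; set tau := t + delta in td0 *.
set W := wker alpha tau.
have W0 : 0 <= W.
  by rewrite divr_ge0 ?powR_ge0// Rintegral_ge0// => s _; rewrite mulr_ge0 ?powR_ge0 ?expR_ge0.
have G0 := @Gamma_gt0 R _ a01.
set lam := Defs.radius T 0 * tau.
have l0 : 0 < lam by rewrite mulr_gt0// radius_gt0.
have l1 : lam <= 2^-1.
  rewrite /lam /Defs.radius invfM -mulrA ler_piMr ?invr_ge0// mulrC ler_pdivrMr//.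
  by rewrite mul1r /tau; lra.
(* The radii of indices 0 and 1 coincide, hence [2 ^+ k] for index [k.+1]. *)
have lE k : Defs.radius T k.+1 * tau = lam * 2 ^+ k.
  by rewrite /lam /Defs.radius; ring.
set S0 := \sum_(j < J) _; set SK := \sum_(k < K) _.
have l20 : 0 < 2 * lam by lra.
have GE := Rintegral_gdens_dyadic K a01 l20.
set G := Gamma (1 - alpha) in G0 GE *.
have -> : W - W / G * (lam `^ (1 - alpha) * S0 + SK) =
    W / G * (G - (lam `^ (1 - alpha) * S0 + SK)).
  by field; rewrite gt_eqF.
have WG0 : 0 <= W / G by rewrite mulr_ge0// invr_ge0 ltW.
rewrite normrM ger0_norm//.
have -> : CKJ (80 + 10 * expR 1 ^+ 2) K J alpha (delta / T) * W =
    W / G * (((80 + 10 * expR 1 ^+ 2) * AJ J) * G +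
      upper_Gamma (1 - alpha) (delta / T * 2 ^+ K)).
  by rewrite /CKJ /BK -/G; field; rewrite gt_eqF.
rewrite ler_wpM2l//.
have err0 := first_error a01 l0 J0 l1 gj0; rewrite -/S0 -/G in err0.
have J1 : 0 < 2 * J%:R :> R by rewrite mulr_gt0// ltr0n.
have lJ0 : 0 < lam / (2 * J%:R) by rewrite divr_gt0.
have errK : `|\sum_(k < K) \int[lebesgue_measure]_(s in
      `]2 * lam * 2 ^+ k, 2 * lam * 2 ^+ k.+1[%classic) gdens alpha s - SK| <=
    80 * AJ J * G.
  rewrite /SK -sumrB (le_trans (ler_norm_sum _ _ _))//.
  have AJ0 : 0 <= 40 * AJ J :> R.
    by rewrite !mulr_ge0// invr_ge0 exprn_ge0// addr_ge0// sqrtr_ge0.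
  have := ler_wpM2l AJ0 (sum_powR_exp_dyadic_le K a01 lJ0).
  rewrite (_ : 40 * AJ J * (2 * _) = 80 * AJ J * G); last by rewrite /G; ring.
  apply: le_trans; rewrite mulr_sumr; apply: ler_sum => k _.
  have lk0 : 0 < lam * 2 ^+ k by rewrite mulr_gt0// exprn_gt0.
  have := legendre_error a01 lk0 J0 gj.
  rewrite lE.
  have -> : 2 * (lam * 2 ^+ k) = 2 * lam * 2 ^+ k by ring.
  have -> : 4 * (lam * 2 ^+ k) = 2 * lam * 2 ^+ k.+1 by rewrite exprS; ring.
  by have -> : lam * 2 ^+ k / (2 * J%:R) = lam / (2 * J%:R) * 2 ^+ k by ring.
(* Here [2 lam = tau / T], which is at least [delta / T] because [t >= 0]. *)
have tail : upper_Gamma (1 - alpha) (2 * lam * 2 ^+ K) <=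
    upper_Gamma (1 - alpha) (delta / T * 2 ^+ K).
  apply: upper_Gamma_le => //; apply/andP; split.
    by rewrite mulr_ge0 ?exprn_ge0// divr_ge0 ?(ltW d0) ?(ltW T0).
  rewrite ler_wpM2r ?exprn_ge0// /lam /Defs.radius.
  have -> : 2 * ((2 * T)^-1 * tau) = tau / T by field; rewrite gt_eqF.
  by rewrite ler_pM2r ?invr_gt0// /tau; lra.
have tail0 : 0 <= upper_Gamma (1 - alpha) (2 * lam * 2 ^+ K).
  by rewrite upper_GammaE Rintegral_ge0// => s _; exact: gdens_ge0.
(* By [GE], the total error is the sum of the first-piece error, the error of the other pieces and
   the nonnegative tail. *)
move: err0 errK; rewrite !ler_norml => /andP[e1 e2] /andP[e3 e4].
apply/andP; split; move: e1 e2 e3 e4 tail tail0 GE.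
  set I0 := Rintegral _ _ _; set IK := \sum_(k < K) Rintegral _ _ _.
  set U := upper_Gamma _ _; set V := upper_Gamma _ _; set E := expR 1 ^+ 2.
  lra.
lra.
Qed.
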